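(* Let $r_0(u)=I_0'(u)/I_0(u)$ and $q_0(u)=I_1(u)/I_0(u)$ for $u>0$. Then $$r_0(10)=q_0(10)=\frac{I_1(10)}{I_0(10)}<\frac{9487}{10000}.$$
   Context: $I_\nu$ is the modified Bessel function of the first kind of order $\nu$: for $u>0$, $I_\nu(u)=\sum_{k\ge0}\frac{(u/2)^{2k+\nu}}{k!\,\Gamma(k+\nu+1)}$. *)

(* Defs.v *)
From Stdlib Require Import Reals Factorial.
From Coquelicot Require Import Coquelicot.
Open Scope R_scope.

(* Euler's integral of t^(x-1) e^(-t) over (0, +oo).  It is improper at both
   ends and converges exactly when x > 0. *)
Definition Gamma (x : R) : R :=
  RInt_gen (fun t => Rpower t (x - 1) * exp (- t))
           (at_right 0) (Rbar_locally p_infty).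

(* Meaningful for u > 0 and nu > -1: [Rpower] is the real power only for a
   positive base, and every argument of [Gamma] must be positive. *)
Definition BesselI (nu u : R) : R :=
  Series (fun k => Rpower (u / 2) (2 * INR k + nu)
                   / (INR (fact k) * Gamma (INR k + nu + 1))).

Definition r0 (u : R) : R := Derive (BesselI 0) u / BesselI 0 u.

Definition q0 (u : R) : R := BesselI 1 u / BesselI 0 u.

(* Main.v *)
Require Import Defs.
From Stdlib Require Import Reals.
From Coquelicot Require Import Coquelicot.
From Stdlib Require Import Lra Lia Factorial.
Open Scope R_scope.

(** At a positive integer, Euler's integral is a factorial, because
    [t ^ n * exp (- t)] has an elementary primitive; hence, for [u > 0],
    [I_0(u)] is the entire power series [bessel_coef] evaluated at
    [(u / 2) ^ 2], and [I_1(u)] is [u / 2] times its term-by-term derivative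
    evaluated there.  The chain rule then gives [I_0' = I_1]
    ([Derive_BesselI_0]), so that [r_0 = q_0].

    For the inequality, write [0.9487 I_0(10) - I_1(10)] as the single series
<<
      sum_k  25^k / (k!)^2 * (0.9487 - 5 / (k + 1)).
>>
    Its terms are nonnegative as soon as [k >= 5], so every partial sum going
    that far is a lower bound for the whole series, and no estimate of the tail
    is needed.  The partial sum up to [k = 11] is a positive rational number,
    and [I_0(10) > 0]. *)

(** * Values of the Gamma function *)

(** This is [n! * sum_(j <= n) t^j / j!].  It solves [P - P' = t ^ n], which is
    what makes [- exp (- t) * P t] a primitive of [t ^ n * exp (- t)]; the
    recursive form avoids dividing by factorials. *)
Fixpoint gamma_poly (n : nat) (t : R) : R :=
  match n with
  | O => 1
  | S m => t ^ S m + INR (S m) * gamma_poly m t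
  end.

Lemma gamma_poly_at_0 (n : nat) : gamma_poly n 0 = INR (fact n).
Proof.
  induction n as [|n IH]; [reflexivity|].
  rewrite fact_simpl, mult_INR, <- IH. cbn [gamma_poly pow]. ring.
Qed.

Lemma is_derive_gamma_poly (n : nat) (t : R) :
  is_derive (gamma_poly n) t (gamma_poly n t - t ^ n).
Proof.
  induction n as [|n IH].
  - apply (is_derive_ext (fun _ => 1)); [reflexivity|].
    replace (gamma_poly 0 t - t ^ 0) with 0 by (simpl; ring).
    apply is_derive_Reals, derivable_pt_lim_const.
  - apply (is_derive_ext (fun s => s ^ S n + INR (S n) * gamma_poly n s));
      [reflexivity|].
    replace (gamma_poly (S n) t - t ^ S n)
      with (INR (S n) * 1 * t ^ n
            + INR (S n) * (gamma_poly n t - t ^ n))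
      by (cbn [gamma_poly]; ring).
    apply (@is_derive_plus R_AbsRing R_NormedModule).
    + apply (is_derive_pow (fun s => s) (S n) t 1).
      exact (@is_derive_id R_AbsRing t).
    + apply is_derive_scal, IH.
Qed.

Definition gamma_primitive (n : nat) (t : R) : R :=
  - (exp (- t) * gamma_poly n t).

Lemma is_derive_gamma_primitive (n : nat) (t : R) :
  is_derive (gamma_primitive n) t (t ^ n * exp (- t)).
Proof.
  unfold gamma_primitive.
  pose proof (is_derive_gamma_poly n t) as D.
  auto_derive.
  - eexists. exact D.
  - rewrite (is_derive_unique (fun x : R => gamma_poly n x) t _ D). ring.
Qed.

(** The Taylor bound [t ^ (n + 1) / (n + 1)! <= exp t] squeezes the function
    between [0] and [(n + 1)! / t]. *)
Lemma is_lim_pow_mul_exp_opp (n : nat) :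
  is_lim (fun t => exp (- t) * t ^ n) p_infty 0.
Proof.
  apply (is_lim_le_le_loc (fun _ => 0) (fun t => INR (fact (S n)) * / t)).
  - exists 1. intros t Ht.
    assert (Hf : 0 < INR (fact (S n))) by apply INR_fact_lt_0.
    assert (Htn : 0 < t ^ n) by (apply pow_lt; lra).
    assert (He : t ^ S n / INR (fact (S n)) <= exp t).
    { eapply Rle_trans; [|apply (exp_ge_taylor t (S n)); lra].
      rewrite tech5.
      assert (0 <= sum_f_R0 (fun k => t ^ k / INR (fact k)) n); [|lra].
      apply cond_pos_sum. intros k.
      apply Rmult_le_pos; [apply pow_le; lra|].
      left. apply Rinv_0_lt_compat, INR_fact_lt_0. }
    rewrite exp_Ropp.
    pose proof (exp_pos t) as Hp.
    split.
    + apply Rmult_le_pos; [left; now apply Rinv_0_lt_compat|lra].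
    + apply Rmult_le_reg_l with (exp t * t); [apply Rmult_lt_0_compat; lra|].
      replace (exp t * t * (/ exp t * t ^ n)) with (t ^ S n)
        by (simpl; field; lra).
      replace (exp t * t * (INR (fact (S n)) * / t))
        with (exp t * INR (fact (S n))) by (field; lra).
      apply Rmult_le_reg_r with (/ INR (fact (S n)));
        [now apply Rinv_0_lt_compat|].
      replace (exp t * INR (fact (S n)) * / INR (fact (S n)))
        with (exp t) by (field; lra).
      exact He.
  - apply is_lim_const.
  - replace (Finite 0) with (Rbar_mult (INR (fact (S n))) 0)
      by (simpl; f_equal; ring).
    apply is_lim_scal_l.
    apply (is_lim_inv (fun t => t) p_infty p_infty); [apply is_lim_id|easy].
Qed.

Lemma is_lim_gamma_primitive (n : nat) :
  is_lim (gamma_primitive n) p_infty 0.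
Proof.
  assert (L : is_lim (fun t => exp (- t) * gamma_poly n t) p_infty 0).
  { induction n as [|n IH].
    - exact (is_lim_pow_mul_exp_opp 0).
    - apply (is_lim_ext (fun t => exp (- t) * t ^ S n
                         + INR (S n) * (exp (- t) * gamma_poly n t))).
      + intros t. cbn [gamma_poly]. ring.
      + replace (Finite 0) with (Finite (0 + INR (S n) * 0)) by (f_equal; ring).
        apply is_lim_plus'; [apply is_lim_pow_mul_exp_opp|].
        exact (is_lim_scal_l _ (INR (S n)) _ _ IH). }
  replace (Finite 0) with (Rbar_opp 0) by (simpl; f_equal; ring).
  apply is_lim_opp, L.
Qed.

(** The primitive is smooth on the whole line, so the improper integral is the
    difference of its limit [0] at infinity and its value [- n!] at [0]. *)
Lemma Gamma_succ_nat (n : nat) : Gamma (INR n + 1) = INR (fact n).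
Proof.
  unfold Gamma.
  apply is_RInt_gen_unique.
  apply (is_RInt_gen_ext (Derive (gamma_primitive n))).
  { exists (fun a => 0 < a) (fun b => 0 < b).
    - exists (mkposreal 1 Rlt_0_1). now intros.
    - now exists 0.
    - intros a b Ha Hb t [Ht _]. simpl in Ht.
      assert (0 < t).
      { eapply Rlt_trans; [|exact Ht]. now apply Rmin_pos. }
      rewrite (is_derive_unique _ _ _ (is_derive_gamma_primitive n t)).
      replace (INR n + 1 - 1) with (INR n) by ring.
      now rewrite Rpower_pow. }
  replace (INR (fact n)) with (0 - gamma_primitive n 0)
    by (unfold gamma_primitive;
        rewrite gamma_poly_at_0, Ropp_0, exp_0; ring).
  apply is_RInt_gen_Derive.
  - apply filter_forall. intros ab t _.
    eexists. apply is_derive_gamma_primitive.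
  - apply filter_forall. intros ab t _.
    apply (continuous_ext (fun s => s ^ n * exp (- s))).
    + intros s. symmetry.
      apply is_derive_unique, is_derive_gamma_primitive.
    + apply (ex_derive_continuous (fun s => s ^ n * exp (- s))).
      auto_derive. trivial.
  - eapply filterlim_filter_le_1; [apply filter_le_within|].
    apply (ex_derive_continuous (gamma_primitive n)).
    eexists. apply is_derive_gamma_primitive.
  - exact (is_lim_gamma_primitive n).
Qed.

(** * Power series for the Bessel functions of orders zero and one *)

Definition bessel_coef (k : nat) : R := / (INR (fact k)) ^ 2.

Lemma bessel_coef_pos (k : nat) : 0 < bessel_coef k.
Proof. apply Rinv_0_lt_compat, pow_lt, INR_fact_lt_0. Qed.

Lemma bessel_coef_succ (k : nat) :
  bessel_coef (S k) = bessel_coef k / INR (S k) ^ 2.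
Proof.
  unfold bessel_coef. rewrite fact_simpl, mult_INR.
  field. split; [apply INR_fact_neq_0|apply not_0_INR; lia].
Qed.

(** The ratio of consecutive coefficients is [1 / (k + 1) ^ 2]. *)
Lemma CV_radius_bessel_coef : CV_radius bessel_coef = p_infty.
Proof.
  apply CV_radius_infinite_DAlembert.
  - intros k. apply Rgt_not_eq, bessel_coef_pos.
  - apply (is_lim_seq_ext (fun k => / INR (S k) * / INR (S k))).
    + intros k. rewrite bessel_coef_succ.
      pose proof (bessel_coef_pos k).
      assert (0 < INR (S k)) by (apply lt_0_INR; lia).
      replace (bessel_coef k / INR (S k) ^ 2 / bessel_coef k)
        with (/ INR (S k) * / INR (S k)) by (field; lra).
      symmetry. apply Rabs_right, Rle_ge, Rlt_le.
      apply Rmult_lt_0_compat; now apply Rinv_0_lt_compat.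
    + assert (L : is_lim_seq (fun k => / INR (S k)) 0).
      { apply (is_lim_seq_incr_1 (fun k => / INR k)).
        apply (is_lim_seq_inv INR p_infty); [apply is_lim_seq_INR|easy]. }
      replace (Finite 0) with (Finite (0 * 0)) by (f_equal; ring).
      now apply is_lim_seq_mult'.
Qed.

Lemma ex_series_bessel_coef (x : R) :
  ex_series (fun k => bessel_coef k * x ^ k).
Proof.
  apply ex_pseries_R, CV_radius_inside. now rewrite CV_radius_bessel_coef.
Qed.

Lemma ex_series_derive_bessel_coef (x : R) :
  ex_series (fun k => PS_derive bessel_coef k * x ^ k).
Proof.
  apply ex_pseries_R, CV_radius_inside.
  now rewrite CV_radius_derive, CV_radius_bessel_coef.
Qed.

Lemma Rpower_double_nat (x : R) (k : nat) :
  0 < x -> Rpower x (2 * INR k) = (x ^ 2) ^ k.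
Proof.
  intros Hx. replace (2 * INR k) with (INR (2 * k)).
  - now rewrite Rpower_pow, pow_mult.
  - rewrite mult_INR. reflexivity.
Qed.

Lemma BesselI_0_PSeries (u : R) :
  0 < u -> BesselI 0 u = PSeries bessel_coef ((u / 2) ^ 2).
Proof.
  intros Hu. apply Series_ext. intros k.
  replace (INR k + 0 + 1) with (INR k + 1) by ring.
  rewrite Gamma_succ_nat, Rplus_0_r, Rpower_double_nat by lra.
  unfold bessel_coef. field. apply INR_fact_neq_0.
Qed.

Lemma BesselI_1_PSeries (u : R) :
  0 < u ->
  BesselI 1 u = u / 2 * PSeries (PS_derive bessel_coef) ((u / 2) ^ 2).
Proof.
  intros Hu. unfold PSeries. rewrite <- Series_scal_l.
  apply Series_ext. intros k.
  replace (INR k + 1 + 1) with (INR (S k) + 1) by (rewrite S_INR; ring).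
  rewrite Gamma_succ_nat, Rpower_plus, Rpower_double_nat, Rpower_1 by lra.
  unfold PS_derive, bessel_coef. rewrite fact_simpl, mult_INR.
  field. split; [apply INR_fact_neq_0|apply not_0_INR; lia].
Qed.

(** The power series represents [BesselI 0] only on the positive half-line,
    where [Rpower] is the real power; this is a neighbourhood of [u]. *)
Lemma Derive_BesselI_0 (u : R) :
  0 < u -> Derive (BesselI 0) u = BesselI 1 u.
Proof.
  intros Hu.
  rewrite (Derive_ext_loc _ (fun v => PSeries bessel_coef ((v / 2) ^ 2))).
  - apply is_derive_unique. rewrite BesselI_1_PSeries by assumption.
    apply (is_derive_comp (PSeries bessel_coef) (fun v => (v / 2) ^ 2)).
    + apply is_derive_PSeries. now rewrite CV_radius_bessel_coef.
    + auto_derive; [trivial|field].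
  - exists (mkposreal u Hu). intros v Hv. apply BesselI_0_PSeries.
    apply Rabs_def2 in Hv. change (v - u < u /\ - u < v - u) in Hv. lra.
Qed.

(** * The numerical bound *)

Lemma sum_f_R0_le_Series (a : nat -> R) (n : nat) :
  ex_series a -> (forall k, (n < k)%nat -> 0 <= a k) ->
  sum_f_R0 a n <= Series a.
Proof.
  intros Ha Hpos.
  rewrite (Series_incr_n a (S n)) by (lia || assumption). simpl pred.
  assert (0 <= Series (fun k => a (S n + k)%nat)); [|lra].
  rewrite <- (Rmult_0_l (Series (fun k => a (S n + k)%nat))), <- Series_scal_l.
  apply Series_le.
  - intros k. rewrite Rmult_0_l. split; [lra|apply Hpos; lia].
  - now apply (ex_series_incr_n a (S n)).
Qed.

(** The [k]-th term of [0.9487 I_0(10) - I_1(10)]: at [u = 10] the [k]-th term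
    of [I_1] is that of [I_0] times [(u / 2) / (k + 1) = 5 / (k + 1)]. *)
Definition gap_term (k : nat) : R :=
  bessel_coef k * 25 ^ k * (9487 / 10000 - 5 / INR (S k)).

Lemma is_series_gap_term :
  is_series gap_term (9487 / 10000 * BesselI 0 10 - BesselI 1 10).
Proof.
  rewrite BesselI_0_PSeries, BesselI_1_PSeries by lra.
  replace ((10 / 2) ^ 2) with 25 by field.
  replace (10 / 2) with 5 by field.
  apply (is_series_ext (fun k =>
    minus (9487 / 10000 * (bessel_coef k * 25 ^ k))
          (5 * (PS_derive bessel_coef k * 25 ^ k)))).
  - intros k. unfold gap_term, PS_derive. rewrite bessel_coef_succ.
    change (9487 / 10000 * (bessel_coef k * 25 ^ k)
      - 5 * (INR (S k) * (bessel_coef k / INR (S k) ^ 2) * 25 ^ k)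
      = bessel_coef k * 25 ^ k * (9487 / 10000 - 5 / INR (S k))).
    field. apply not_0_INR; lia.
  - apply (@is_series_minus R_AbsRing R_NormedModule).
    + apply (is_series_scal_l (9487 / 10000) (fun k => bessel_coef k * 25 ^ k)).
      apply Series_correct, ex_series_bessel_coef.
    + apply (is_series_scal_l 5 (fun k => PS_derive bessel_coef k * 25 ^ k)).
      apply Series_correct, ex_series_derive_bessel_coef.
Qed.

Lemma gap_term_nonneg (k : nat) : (11 < k)%nat -> 0 <= gap_term k.
Proof.
  intros Hk. unfold gap_term.
  apply Rmult_le_pos.
  - apply Rmult_le_pos; [apply Rlt_le, bessel_coef_pos|apply pow_le; lra].
  - assert (H6 : 6 <= INR (S k))
      by (replace 6 with (INR 6) by (simpl; ring); apply le_INR; lia).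
    assert (5 / INR (S k) <= 5 / 6); [|lra].
    apply Rmult_le_compat_l; [lra|]. apply Rinv_le_contravar; lra.
Qed.

(** The terms with [k <= 4] are negative, and [11] is the first index at which
    the partial sums become positive; the value there is about [0.109]. *)
Lemma sum_gap_term_pos : 0 < sum_f_R0 gap_term 11.
Proof.
  assert (H0 : bessel_coef 0 = 1) by (unfold bessel_coef; simpl; field).
  unfold gap_term. cbn [sum_f_R0].
  rewrite !bessel_coef_succ, H0, !S_INR. simpl INR. lra.
Qed.

Lemma BesselI_0_pos (u : R) : 0 < u -> 0 < BesselI 0 u.
Proof.
  intros Hu. rewrite BesselI_0_PSeries by assumption.
  apply Rlt_le_trans with
    (sum_f_R0 (fun k => bessel_coef k * ((u / 2) ^ 2) ^ k) 0).
  - simpl. rewrite Rmult_1_r. apply bessel_coef_pos.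
  - apply sum_f_R0_le_Series.
    + apply ex_series_bessel_coef.
    + intros k _. apply Rmult_le_pos; [apply Rlt_le, bessel_coef_pos|].
      apply pow_le, pow2_ge_0.
Qed.

Theorem lemma4p1 :
  r0 10 = q0 10 /\
  q0 10 = BesselI 1 10 / BesselI 0 10 /\
  BesselI 1 10 / BesselI 0 10 < 9487 / 10000.
Proof.
  split; [|split].
  - unfold r0, q0. now rewrite Derive_BesselI_0 by lra.
  - reflexivity.
  - pose proof (BesselI_0_pos 10 ltac:(lra)) as H0.
    apply Rlt_div_l; [exact H0|].
    pose proof sum_gap_term_pos as Hsum.
    pose proof (sum_f_R0_le_Series gap_term 11
      (ex_intro _ _ is_series_gap_term) gap_term_nonneg) as Hle.
    rewrite (is_series_unique _ _ is_series_gap_term) in Hle.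
    lra.
Qed.
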